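(* Let $G(s)$ be a proper real rational transfer function such that: (1) $G(s)$ has no poles in the open right half plane; (2) any poles of $G(s)$ on the imaginary axis are simple with positive residues; (3) for some $a\in\mathbb{R}$, the Nyquist plot of $G(s)$ lies to the right of the vertical line $\mathrm{Re}\{s\}=a$, i.e. $\mathrm{Re}\{G(\hat{j}\omega)\}\ge a$ for all $\omega\in\mathbb{R}$ (for which $\hat{j}\omega$ is not a pole). Let $0<\alpha\le 1$. Then the Nyquist plot of $G(s^\alpha)$ lies to the right of the same line, i.e. $\mathrm{Re}\{G((\hat{j}\omega)^\alpha)\}\ge a$ for all $\omega\in\mathbb{R}$ (for which $(\hat{j}\omega)^\alpha$ is not a pole of $G$). Also, if $G(s)$ has no poles on the imaginary axis and its Nyquist plot lies to the left of the vertical line $\mathrm{Re}\{s\}=b$, i.e. $\mathrm{Re}\{G(\hat{j}\omega)\}\le b$ for all $\omega\in\mathbb{R}$, then the Nyquist plot of $G(s^\alpha)$ lies to the left of the same line, i.e. $\mathrm{Re}\{G((\hat{j}\omega)^\alpha)\}\le b$ for all $\omega\in\mathbb{R}$.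
   Context: $\hat{j}=\sqrt{-1}$. The power $s^\alpha$ is the principal value: for $s=re^{\hat{j}\theta}$ with $r\geq 0$, $-\pi<\theta\le\pi$, $s^\alpha=r^\alpha e^{\hat{j}\alpha\theta}$. The Nyquist plot of a transfer function $F(s)$ is the set of values $F(\hat{j}\omega)$, $\omega\in\mathbb{R}$; the Nyquist plot of $G(s^\alpha)$ is the set of values $G((\hat{j}\omega)^\alpha)$, $\omega\in\mathbb{R}$. *)

(* Defs.v *)
From mathcomp Require Import all_boot all_order all_algebra.
From mathcomp Require Import all_classical all_reals all_analysis.
From mathcomp Require Export complex.

Set Implicit Arguments.
Unset Strict Implicit.
Unset Printing Implicit Defensive.

Import Order.TTheory GRing.Theory Num.Theory.
Import numFieldNormedType.Exports.

Local Open Scope classical_set_scope.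
Local Open Scope ring_scope.
Local Open Scope complex_scope.

(* Numerator and denominator have no common factor, so that the poles are
   exactly the complex roots of the denominator, with their multiplicities. *)
Record transfer_function (R : realType) := TransferFunction {
  tf_num : {poly R};
  tf_den : {poly R};
  tf_den_neq0 : tf_den != 0;
  tf_coprime : coprimep tf_num tf_den
}.

Section TransferFunction.
Variables (R : realType) (G : transfer_function R).

Definition proper_tf : Prop := (size (tf_num G) <= size (tf_den G))%N.

Definition polyC_of (p : {poly R}) : {poly R[i]} :=
  map_poly (real_complex R) p.

(* Meaningful only where [s] is not a pole; at a pole it is 0 by the
   convention [x / 0 = 0]. *)
Definition tf_eval (s : R[i]) : R[i] :=
  (polyC_of (tf_num G)).[s] / (polyC_of (tf_den G)).[s].

Definition tf_pole (s : R[i]) : Prop := root (polyC_of (tf_den G)) s.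

Definition tf_simple_pole (s : R[i]) : Prop :=
  mup s (polyC_of (tf_den G)) = 1%N.

(* At a simple pole [s0], the residue is the limit of [(s - s0) G(s)].
   [R[i]^o] carries the topology of the complex modulus. *)
Definition tf_simple_pole_residue (s0 r : R[i]) : Prop :=
  tf_simple_pole s0 /\
  (fun s : R[i]^o => (s - s0) * tf_eval s : R[i]^o) @ (s0 : R[i]^o)^' --> (r : R[i]^o).

End TransferFunction.

Section PrincipalPower.
Variable R : realType.

Definition cpolar (r theta : R) : R[i] := (r * cos theta) +i* (r * sin theta).

Definition cmod (s : R[i]) : R := Num.sqrt (complex.Re s ^+ 2 + complex.Im s ^+ 2).

(* Principal argument, with values in ]-pi, pi]; [carg 0 = acos 0] is
   immaterial, since [cpow 0 alpha = 0] for [alpha != 0]. *)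
Definition carg (s : R[i]) : R :=
  if 0 <= complex.Im s then acos (complex.Re s / cmod s)
  else - acos (complex.Re s / cmod s).

Definition cpow (s : R[i]) (alpha : R) : R[i] :=
  cpolar (cmod s `^ alpha) (alpha * carg s).

Lemma cmod_polar (r theta : R) : 0 <= r -> cmod (cpolar r theta) = r.
Proof.
move=> r0; rewrite /cmod /= !exprMn -mulrDr cos2Dsin2 mulr1 sqrtr_sqr.
exact: ger0_norm.
Qed.

Lemma carg_polar (r theta : R) : 0 < r -> - pi < theta <= pi ->
  carg (cpolar r theta) = theta.
Proof.
move=> r0 /andP[t1 t2]; rewrite /carg cmod_polar /=; last exact: ltW.
have -> : r * cos theta / r = cos theta by rewrite mulrAC divff ?gt_eqF// mul1r.
rewrite (pmulr_rge0 _ r0).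
have [t0|t0] := leP 0 theta.
  by rewrite sin_ge0_pi ?t0// cosK// in_itv/= t0.
have: 0 < sin (- theta) by rewrite sin_gt0_pi// oppr_gt0 t0 ltrNl.
rewrite sinN oppr_gt0 => st; rewrite leNgt st /= cosKN ?opprK//.
by rewrite !ltW.
Qed.

Lemma cpow_polar (r theta alpha : R) : 0 <= r -> - pi < theta <= pi ->
  0 < alpha -> cpow (cpolar r theta) alpha = cpolar (r `^ alpha) (alpha * theta).
Proof.
rewrite le_eqVlt => /predU1P[<-|r0] tpi a0; last first.
  by rewrite /cpow cmod_polar ?ltW// carg_polar.
by rewrite /cpow cmod_polar// powR0 ?gt_eqF// /cpolar !mul0r.
Qed.


End PrincipalPower.

(* Main.v *)
Require Import Defs.
From mathcomp Require Import all_boot all_order all_algebra.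
From mathcomp Require Import all_classical all_reals all_analysis.
From mathcomp Require Import ring lra.
Import Order.TTheory GRing.Theory Num.Theory.
Import numFieldNormedType.Exports.

(** The power [(jw)^alpha] has argument at most [pi / 2] in absolute value
    ([Re_cpow_axis_ge0]), so it lies in the closed right half-plane.  It is thus
    enough to know that a bound on the real part of [G] on the imaginary axis
    propagates to that half-plane, which is a minimum principle for the
    harmonic function [Re G].

    Replacing [G] by [G - a], or by [b - G], reduces both halves to the lower
    bound [0].  When there is no pole in the closed half-plane, properness
    gives a limit at infinity ([div_near_infinity]), so a negative value would
    force a negative global minimum, attained by compactness at an interior
    point; the local form of a rational function excludes this
    ([Re_div_descent], [Re_div_ge0_no_pole]).  A simple pole [s1] on the axis
    with residue [r > 0] contributes [r / (s - s1)], whose real part vanishes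
    on the axis and is positive inside the half-plane; subtracting these terms
    one by one reduces to the case without poles ([Re_div_ge0]).  The residue,
    given as a limit, is read off the factorization of the denominator in
    [residue_horner]. *)

Local Open Scope classical_set_scope.
Local Open Scope ring_scope.
Local Open Scope complex_scope.

(** * Real parts of quotients, and continuity *)

(** The real inner product of [R[i]] seen as the plane, that is the real part
    of [x] times the conjugate of [y].  It has the sign of the real part of
    [x / y], stays meaningful where [y] vanishes, and is polynomial in the
    coordinates. *)
Definition rdot {R : realType} (x y : R[i]) : R :=
  complex.Re x * complex.Re y + complex.Im x * complex.Im y.

Lemma Re_addc (R : realType) (x y : R[i]) :
  complex.Re (x + y) = complex.Re x + complex.Re y.
Proof. by case: x; case: y. Qed.

Lemma Re_real_mulc (R : realType) (a : R) (x : R[i]) :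
  complex.Re (a%:C * x) = a * complex.Re x.
Proof. by case: x => x y /=; rewrite mul0r subr0. Qed.

Lemma rdotxx_gt0 (R : realType) (y : R[i]) : y != 0 -> 0 < rdot y y.
Proof.
case: y => a b; rewrite eq_complex /= negb_and /rdot /= -!expr2 => ab.
by rewrite lt_neqAle addr_ge0 ?sqr_ge0// eq_sym paddr_eq0 ?sqr_ge0// !sqrf_eq0
  negb_and ab.
Qed.

Lemma Re_div_rdot (R : realType) (x y : R[i]) :
  complex.Re (x / y) = rdot x y / rdot y y.
Proof. by case: x y => a b [c d]; rewrite /rdot /= -!expr2; ring. Qed.

(** The plane is taken as the product [R * R], whose compact boxes and
    continuous real functions serve for the extreme value theorem below. *)
Lemma continuous_Re_Im_horner (R : realType) (p : {poly R[i]}) :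
  continuous (fun z : R * R => complex.Re p.[z.1 +i* z.2]) /\
  continuous (fun z : R * R => complex.Im p.[z.1 +i* z.2]).
Proof.
elim/poly_ind: p => [|p c [ihr ihi]].
  by split; under eq_fun do rewrite horner0 /=; move=> z; exact: cvg_cst.
have c1 : continuous (fun z : R * R => z.1) by move=> z; exact: cvg_fst.
have c2 : continuous (fun z : R * R => z.2) by move=> z; exact: cvg_snd.
have E z : p.[z.1 +i* z.2] * (z.1 +i* z.2) =
   (complex.Re p.[z.1 +i* z.2] * z.1 - complex.Im p.[z.1 +i* z.2] * z.2) +i*
   (complex.Re p.[z.1 +i* z.2] * z.2 + complex.Im p.[z.1 +i* z.2] * z.1).
  by case: (p.[_]) => a b.
split; under eq_fun do rewrite hornerMXaddC E raddfD /=; move=> z.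
  apply: cvgD; last exact: cvg_cst.
  by apply: cvgB; apply: cvgM; [exact: ihr|exact: c1|exact: ihi|exact: c2].
apply: cvgD; last exact: cvg_cst.
by apply: cvgD; apply: cvgM; [exact: ihr|exact: c2|exact: ihi|exact: c1].
Qed.

Lemma continuous_rdot_horner (R : realType) (p q : {poly R[i]}) :
  continuous (fun z : R * R => rdot p.[z.1 +i* z.2] q.[z.1 +i* z.2]).
Proof.
have [pr pim] := continuous_Re_Im_horner R p.
have [qr qim] := continuous_Re_Im_horner R q.
by move=> z; apply: cvgD; apply: cvgM;
  [exact: pr|exact: qr|exact: pim|exact: qim].
Qed.

Lemma continuous_rdot_line (R : realType) (p q : {poly R[i]}) (s u : R[i]) :
  continuous (fun t : R => rdot p.[s + t%:C * u] q.[s + t%:C * u]).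
Proof.
pose L := s%:P + u *: 'X.
have LE (r : {poly R[i]}) (t : R) : r.[s + t%:C * u] = (r \Po L).[t +i* 0].
  by rewrite horner_comp hornerD hornerC hornerZ hornerX complexr0 [u * _]mulrC.
under eq_fun do rewrite !LE.
move=> t; apply: (@continuous_comp _ _ _ (fun t : R => (t, 0 : R))
  (fun z : R * R => rdot (p \Po L).[z.1 +i* z.2] (q \Po L).[z.1 +i* z.2])).
  by apply: (@cvg_pair _ _ _ (nbhs t) (nbhs t) (nbhs (0 : R)));
    [exact: cvg_id|exact: cvg_cst].
exact: continuous_rdot_horner.
Qed.

(** * Behaviour at infinity *)

(** The factor [`|s|] on the left spares a case distinction on [n = 0]. *)
Lemma horner_le_exp (R : realType) (p : {poly R[i]}) (n : nat) :
  (size p <= n)%N -> exists C : R[i], 0 <= C /\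
    forall s, 1 <= `|s| -> `|p.[s]| * `|s| <= C * `|s| ^+ n.
Proof.
move=> pn; exists (\sum_(i < n) `|p`_i|); split; first exact: sumr_ge0.
move=> s s1; rewrite (horner_coef_wide _ pn) mulr_suml.
apply: le_trans (ler_wpM2r _ (ler_norm_sum _ _ _)) _ => //.
rewrite mulr_suml ler_sum // => i _; rewrite normrM normrX -mulrA -exprSr.
by rewrite ler_wpM2l// ler_weXn2l.
Qed.

(** A proper quotient [P / Q] has a limit [c] at infinity; the inequality is
    multiplied out so that it needs no hypothesis on the zeros of [Q]. *)
Lemma div_near_infinity (R : realType) (P Q : {poly R[i]}) (e : R) :
  Q != 0 -> (size P <= size Q)%N -> 0 < e ->
  exists (c : R[i]) (M : R), forall s, M%:C <= `|s| ->
    `|P.[s] - c * Q.[s]| <= e%:C * `|Q.[s]|.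
Proof.
move=> Q0 PQ e0; set n := (size Q).-1.
have szQ : size Q = n.+1 by rewrite prednK// size_poly_gt0.
set q := lead_coef Q; have q0 : q != 0 by rewrite lead_coef_eq0.
pose c := P`_n / q.
have szT : (size (P - c *: Q)%R <= n)%N.
  apply/leq_sizeP => j; rewrite leq_eqVlt => /predU1P[<-|nj].
    by rewrite coefB coefZ /c -/n [Q`_n]/(lead_coef Q) -/q divfK ?subrr.
  by rewrite coefB coefZ !nth_default ?mulr0 ?subrr// ?szQ//;
    apply: leq_trans PQ _; rewrite szQ.
have szU : (size (Q - q *: 'X^n)%R <= n)%N.
  apply/leq_sizeP => j; rewrite leq_eqVlt => /predU1P[<-|nj].
    by rewrite coefB coefZ coefXn eqxx mulr1 -/n [Q`_n]/(lead_coef Q) subrr.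
  by rewrite coefB coefZ coefXn gtn_eqF// mulr0 subr0 nth_default// szQ.
have [C [C0 hC]] := horner_le_exp _ _ _ szT.
have [D [D0 hD]] := horner_le_exp _ _ _ szU.
have eC : 0 < e%:C :> R[i] by rewrite ltcR.
(* For |s| >= 1, the bound C on the remainder is dominated by
   e * (|q| |s| - D) as soon as |s| >= (C / e + D) / |q|. *)
pose M := 1 + (C / e%:C + D) / `|q|.
have nq0 : 0 < `|q| by rewrite normr_gt0.
have M1 : 1 <= M by rewrite lerDl divr_ge0// addr_ge0// divr_ge0// ltW.
have Mr : (complex.Re M)%:C = M
  by apply: RRe_real; rewrite ger0_real// (le_trans _ M1).
exists c, (complex.Re M) => s; rewrite Mr => Ms.
have s1 : 1 <= `|s| by exact: le_trans Ms.
have s0 : 0 < `|s| by exact: lt_le_trans s1.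
rewrite -(ler_pM2r s0).
have := hC s s1; rewrite hornerD hornerN hornerZ => /le_trans; apply.
have Qs : (`|q| * `|s| - D) * `|s| ^+ n <= `|Q.[s]| * `|s|.
  have -> : Q.[s] = q * s ^+ n + (Q - q *: 'X^n).[s].
    by rewrite hornerD hornerN hornerZ hornerXn [RHS]addrC subrK.
  rewrite mulrBl lerBlDr; apply: le_trans (lerD (lexx _) (hD s s1)).
  rewrite -mulrDl mulrAC ler_wpM2r//.
  rewrite -normrX -normrM -lerBlDr.
  set a := q * _; set b := _.[s].
  have := lerB_normD a b; done.
rewrite -mulrA; apply: le_trans (ler_wpM2l (ltW eC) Qs).
rewrite mulrA ler_wpM2r ?exprn_ge0// mulrC -ler_pdivrMr//.
rewrite lerBrDr -ler_pdivrMl// mulrC.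
by apply: le_trans Ms; rewrite lerDr.
Qed.

(** * The minimum principle *)

(** Where [P / Q] is defined and not constant, its real part is no local
    minimum: with [v] the value of the quotient at [s1], and [P / Q - v]
    written as [(s - s1) ^+ k * N1 s / Q s] with [N1 s1 != 0] and [k > 0], it
    decreases in any direction [u] making [u ^+ k * N1 s1 / Q s1] negative. *)
Lemma Re_div_descent (R : realType) (P Q : {poly R[i]}) (s1 : R[i]) :
  Q.[s1] != 0 -> P != (P.[s1] / Q.[s1]) *: Q ->
  exists u : R[i], \forall t \near (0 : R)^'+, Q.[s1 + t%:C * u] != 0 /\
    complex.Re (P.[s1 + t%:C * u] / Q.[s1 + t%:C * u]) <
    complex.Re (P.[s1] / Q.[s1]).
Proof.
move=> Qs1; set v := _ / _; rewrite -subr_eq0 => N0.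
have [k [N1]] := multiplicity_XsubC (P - v *: Q) s1.
rewrite N0 /= rootE => N1s EN.
have k0 : (0 < k)%N.
  rewrite lt0n; apply: contra N1s => /eqP k0; move: EN.
  rewrite k0 expr0 mulr1 => <-.
  by rewrite !hornerE /v divfK ?subrr.
pose u := (k.-root (- (Q.[s1] / N1.[s1])))%R.
have uk : u ^+ k = - (Q.[s1] / N1.[s1]) by rewrite rootCK.
exists u.
pose g (t : R) :=
  rdot (u ^+ k *: N1).[s1 + t%:C * u] Q.[s1 + t%:C * u].
have gE t : g t = rdot (u ^+ k * N1.[s1 + t%:C * u]) Q.[s1 + t%:C * u].
  by rewrite /g hornerZ.
have g0 : g 0 < 0.
  rewrite gE mul0r addr0 uk mulNr divfK//.
  rewrite /rdot !raddfN /= !mulNr -opprD oppr_lt0.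
  exact: rdotxx_gt0.
have ng : \forall t \near (0 : R)^'+, g t < 0.
  apply: (cvgr_lt (g 0)) g0; apply: cvg_at_right_filter.
  exact: continuous_rdot_line.
near=> t.
have t0 : 0 < t by near: t; exact: nbhs_right_gt.
have gt0 : g t < 0 by near: t.
set s := s1 + t%:C * u in gE *.
have Qs : Q.[s] != 0.
  apply: contraTneq gt0 => Qs; rewrite gE -/s Qs /rdot /= !mulr0 addr0 ltxx//.
split=> //.
have -> : P.[s] / Q.[s] = v + (t ^+ k)%:C * ((u ^+ k * N1.[s]) / Q.[s]).
  have: (P - v *: Q).[s] = (t ^+ k)%:C * (u ^+ k * N1.[s]).
    rewrite EN !hornerE /s addrAC subrr add0r rmorphXn /= exprMn.
    by rewrite mulrC.
  rewrite hornerD hornerN hornerZ => /eqP; rewrite subr_eq => /eqP ->.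
  by rewrite mulrDl mulfK// [LHS]addrC !mulrA.
rewrite Re_addc Re_real_mulc -ltrBrDl subrr Re_div_rdot -gE.
rewrite pmulr_rlt0 ?exprn_gt0//.
by rewrite pmulr_llt0// invr_gt0 rdotxx_gt0.
Unshelve. all: by end_near.
Qed.

(** The minimum principle on the closed right half-plane.  If the real part were
    negative at [s0], it would stay above its value at [s0] outside a large
    box, because the limit at infinity is also a limit along the imaginary
    axis.  Hence it would have a negative global minimum, necessarily inside
    the open half-plane, against [Re_div_descent]. *)
Lemma Re_div_ge0_no_pole (R : realType) (P Q : {poly R[i]}) :
  (size P <= size Q)%N ->
  (forall s : R[i], 0 <= complex.Re s -> Q.[s] != 0) ->
  (forall w : R, 0 <= complex.Re (P.[0 +i* w] / Q.[0 +i* w])) ->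
  forall s : R[i], 0 <= complex.Re s -> 0 <= complex.Re (P.[s] / Q.[s]).
Proof.
move=> PQ Qn0 axis s0 Res0.
pose f (s : R[i]) := complex.Re (P.[s] / Q.[s]).
rewrite -[complex.Re _]/(f s0) leNgt; apply/negP => fs0.
have Q0 : Q != 0 by apply: contraNneq (Qn0 0 (lexx _)) => ->; rewrite horner0.
(* A quarter suffices: the values at two points far away then differ by at most
   half of -f s0. *)
have e0 : 0 < - f s0 / 4 by rewrite divr_gt0// oppr_gt0.
have [c [M hM]] := div_near_infinity R P Q _ Q0 PQ e0.
have far s : 0 <= complex.Re s -> M%:C <= `|s| ->
    `|f s - complex.Re c| <= - f s0 / 4.
  move=> Rs /hM h; have Qs := Qn0 _ Rs.
  have : `|P.[s] / Q.[s] - c| <= (- f s0 / 4)%:C.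
    rewrite -[X in _ - X](mulfK Qs) -mulrBl normrM normfV ler_pdivrMr//.
    by rewrite normr_gt0.
  rewrite -lecR; apply: le_trans; rewrite /f.
  by have := normc_ge_Re (P.[s] / Q.[s] - c); rewrite raddfB.
(* The box [0, B] x [-B, B] contains s0, and the estimate holds outside it. *)
pose B : R := `|M| + complex.Re s0 + `|complex.Im s0|.
have MB : M <= B by rewrite (le_trans (ler_norm _))// /B -addrA lerDl addr_ge0.
have B0 : 0 <= B by rewrite !addr_ge0.
have outside s : B <= complex.Re s \/ B <= `|complex.Im s| -> M%:C <= `|s|.
  move=> Bs; apply: (@le_trans _ _ B%:C); first by rewrite lecR.
  rewrite normc_def lecR -[B]ger0_norm// -sqrtr_sqr ler_wsqrtr//.
  case: Bs => Bs.
    by rewrite ler_wpDr ?sqr_ge0// lerXn2r// nnegrE (le_trans B0).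
  by rewrite ler_wpDl ?sqr_ge0// -[leRHS]real_normK ?num_real// lerXn2r// nnegrE.
have far_gt s : 0 <= complex.Re s -> M%:C <= `|s| -> f s0 < f s.
  move=> Rs /(far _ Rs); rewrite ler_distl => /andP[h1 _].
  have := far (0 +i* B) (lexx _) (outside (0 +i* B) (or_intror (ler_norm _))).
  rewrite ler_distl => /andP[_ h2].
  have := axis B; rewrite -[complex.Re _]/(f (0 +i* B)); lra.
pose A : set (R * R) := `[0, B] `*` `[- B, B].
pose h (z : R * R) := f (z.1 +i* z.2).
have As0 : A (complex.Re s0, complex.Im s0).
  split; rewrite /= in_itv /=; first by rewrite Res0 /B addrAC lerDr addr_ge0.
  by rewrite -ler_norml /B lerDr addr_ge0.
have ch : {within A, continuous h}.
  apply: continuous_in_subspaceT => z; rewrite inE => -[]/=.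
  rewrite !in_itv /= => /andP[z1 _] _.
  have -> : h = (fun z => rdot P.[z.1 +i* z.2] Q.[z.1 +i* z.2] /
                          rdot Q.[z.1 +i* z.2] Q.[z.1 +i* z.2]).
    by apply/funext => ?; exact: Re_div_rdot.
  apply: cvgM; first exact: continuous_rdot_horner.
  apply: cvgV; last exact: continuous_rdot_horner.
  by rewrite gt_eqF// rdotxx_gt0// Qn0.
have [z Az zmin] := compact_EVT_min (ex_intro _ _ As0)
  (compact_setX (@segment_compact _ _ _) (@segment_compact _ _ _)) ch.
set s1 := z.1 +i* z.2; have fs1 : f s1 <= f s0.
  by have := zmin _ (mem_set As0); rewrite /h /=; case: (s0).
have Rs1 : 0 <= complex.Re s1.
  by move: Az; rewrite inE => -[]/=; rewrite in_itv /= => /andP[].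
have glob s : 0 <= complex.Re s -> f s1 <= f s.
  move=> Rs; have [As|nAs] := pselect (A (complex.Re s, complex.Im s)).
    by have := zmin _ (mem_set As); rewrite /h /=; case: (s).
  apply: (le_trans fs1); apply/ltW/far_gt => //; apply: outside.
  have [?|ReB] := leP B (complex.Re s); first by left.
  have [?|ImB] := leP B `|complex.Im s|; first by right.
  exfalso; apply: nAs; split; rewrite /= in_itv /= ?Rs ?(ltW ReB)//.
  by rewrite -ler_norml ltW.
have Rs1_gt0 : 0 < complex.Re s1.
  rewrite lt_neqAle Rs1 andbT; apply/eqP => Rs10.
  have s1E : s1 = 0 +i* z.2 by rewrite Rs10.
  have : 0 <= f s1 by rewrite s1E; exact: axis.
  by rewrite leNgt (le_lt_trans fs1).
have Qs1 := Qn0 _ Rs1.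
have [PvQ|/(Re_div_descent _ _ _ _ Qs1)[u hu]] :=
    eqVneq P ((P.[s1] / Q.[s1]) *: Q).
  have : 0 <= f s1 by have := axis 0; rewrite {1}PvQ hornerZ mulfK ?Qn0.
  by rewrite leNgt (le_lt_trans fs1).
(* A small step along u stays in the half-plane and goes below the minimum. *)
near (0 : R)^'+ => t.
have [_] : Q.[s1 + t%:C * u] != 0 /\ f (s1 + t%:C * u) < f s1 by near: t.
apply/negP; rewrite -leNgt glob//.
have t0 : 0 < t by near: t; exact: nbhs_right_gt.
have u0 : 0 < `|complex.Re u| + 1 by rewrite ltr_wpDl.
have tu : t < complex.Re s1 / (`|complex.Re u| + 1).
  by near: t; apply: nbhs_right_lt; rewrite divr_gt0.
rewrite Re_addc Re_real_mulc -lerBlDr sub0r.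
rewrite -mulrN ltW// (le_lt_trans _ (_ : t * (`|complex.Re u| + 1) < _))//.
  by rewrite ler_wpM2l ?(ltW t0)// (le_trans (ler_norm _))// normrN lerDl.
by rewrite -ltr_pdivlMr.
Unshelve. all: by end_near.
Qed.

(** The same with simple poles on the imaginary axis, where the fourth
    hypothesis says, without mentioning limits, that every residue is a
    positive real; the condition on the axis is stated with [rdot] so as to hold
    also at the poles.  The poles are removed one at a time: subtracting
    [r / (s - s1)] does not change the real part on the axis, and the term
    subtracted has a nonnegative real part on the half-plane. *)
Lemma Re_div_ge0 (R : realType) (P Q : {poly R[i]}) :
  Q != 0 -> (size P <= size Q)%N ->
  (forall s : R[i], root Q s -> ~ 0 < complex.Re s) ->
  (forall (s : R[i]) (Q1 : {poly R[i]}), complex.Re s = 0 ->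
     Q = Q1 * ('X - s%:P) ->
     exists r : R, [/\ 0 < r, Q1.[s] != 0 & P.[s] = r%:C * Q1.[s]]) ->
  (forall w : R, 0 <= rdot P.[0 +i* w] Q.[0 +i* w]) ->
  forall s : R[i], 0 <= complex.Re s -> Q.[s] != 0 ->
    0 <= complex.Re (P.[s] / Q.[s]).
Proof.
move: {2}(size Q) (leqnn (size Q)) => n.
elim: n P Q => [|n IHn] P Q Qn Q0 PQ rhp res axis s Rs Qs.
  by move: Qn; rewrite leqn0 size_poly_eq0 (negbTE Q0).
have [[s1 [Rs1 /factor_theorem[Q1 EQ]]]|nopole] :=
    pselect (exists s1 : R[i], complex.Re s1 = 0 /\ root Q s1); last first.
  apply: Re_div_ge0_no_pole => // [z Rz|w].
    rewrite -rootE; apply/negP => rz; move: Rz; rewrite le_eqVlt => /predU1P[Rz|].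
      by apply: nopole; exists z.
    exact: rhp.
  by rewrite Re_div_rdot mulr_ge0// invr_ge0 addr_ge0// -expr2 sqr_ge0.
have [r [r0 Q1s1 Ps1]] := res _ _ Rs1 EQ.
have [P' EP'] : exists P', P - r%:C *: Q1 = P' * ('X - s1%:P).
  by apply/factor_theorem; rewrite rootE hornerD hornerN hornerZ Ps1 subrr.
have EP : P = P' * ('X - s1%:P) + r%:C *: Q1 by rewrite -EP' subrK.
have Q10 : Q1 != 0 by apply: contraNneq Q1s1 => ->; rewrite horner0.
have szM (p : {poly R[i]}) : p != 0 -> size (p * ('X - s1%:P)) = (size p).+1.
  by move=> p0; rewrite size_Mmonic ?monicXsubC// size_XsubC addn2.
have szQ : size Q = (size Q1).+1 by rewrite EQ szM.
have P'Q1 : (size P' <= size Q1)%N.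
  have [->|P'0] := eqVneq P' 0; first by rewrite size_poly0.
  rewrite -ltnS -szM// -EP' -szQ (leq_trans (size_polyD _ _))// geq_max PQ.
  by rewrite size_polyN (leq_trans (size_scale_leq _ _))// szQ.
have hQ (z : R[i]) : Q.[z] = Q1.[z] * (z - s1).
  by rewrite EQ hornerM hornerXsubC.
have hP (z : R[i]) : P.[z] = P'.[z] * (z - s1) + r%:C * Q1.[z].
  by rewrite {1}EP hornerD hornerM hornerXsubC hornerZ.
move: Qs; rewrite hQ mulf_eq0 negb_or => /andP[Q1s ss1].
have -> : P.[s] / (Q1.[s] * (s - s1)) = P'.[s] / Q1.[s] + r%:C * (s - s1)^-1.
  by rewrite hP; field; rewrite ss1 Q1s.
rewrite Re_addc Re_real_mulc addr_ge0//; last first.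
  rewrite mulr_ge0 ?(ltW r0)// -[_^-1]mul1r Re_div_rdot.
  rewrite divr_ge0// ?(ltW (rdotxx_gt0 _ _ ss1))//.
  rewrite /rdot /= mul1r mul0r addr0 Re_addc.
  have -> : complex.Re (- s1) = 0 by case: (s1) Rs1 => /= ? ? ->; rewrite oppr0.
  by rewrite addr0.
apply: IHn => //.
- by rewrite -ltnS -szQ.
- by move=> z rz; apply: rhp; rewrite rootE hQ (rootP rz) mul0r.
- move=> z Q2 Rz EQ1; have Q1z : Q1.[z] = 0.
    by rewrite EQ1 hornerM hornerXsubC subrr mulr0.
  have zs1 : z - s1 != 0.
    by rewrite subr_eq0; apply: contraNneq Q1s1 => <-; rewrite Q1z.
  have [|r2 [r20 Q2z Pz]] := res z (Q2 * ('X - s1%:P)) Rz.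
    by rewrite EQ EQ1 mulrAC.
  move: Q2z Pz; rewrite hP Q1z mulr0 addr0 hornerM hornerXsubC mulrA => Q2z.
  move=> /(mulIf zs1) P'z; exists r2; split=> //.
  by apply: contraNneq Q2z => ->; rewrite mul0r.
(* The axis condition for P' / Q1 follows from that for P / Q away from s1, and
   at s1 itself by continuity. *)
pose g (w : R) := rdot P'.[0 + w%:C * 'i] Q1.[0 + w%:C * 'i].
have iE (w : R) : 0 + w%:C * 'i = 0 +i* w.
  rewrite add0r; apply/eqP; rewrite eq_complex /=.
  by apply/andP; split; apply/eqP; ring.
have gE (w : R) : g w = rdot P'.[0 +i* w] Q1.[0 +i* w] by rewrite /g iE.
have g_off (w : R) : w != complex.Im s1 -> 0 <= g w.
  move=> w1; have d2 : 0 < (w - complex.Im s1) ^+ 2.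
    by rewrite exprn_even_gt0//= subr_eq0.
  rewrite -(pmulr_rge0 _ d2) gE.
  suff <- : rdot P.[0 +i* w] Q.[0 +i* w] = (w - complex.Im s1) ^+ 2 *
      rdot P'.[0 +i* w] Q1.[0 +i* w] by exact: axis.
  rewrite hP hQ; case: (P'.[_]) => a b; case: (Q1.[_]) => c d.
  case: (s1) Rs1 => x y /= ->; rewrite /rdot /=; ring.
move=> w; rewrite -gE; have [->|] := eqVneq w (complex.Im s1); last exact: g_off.
rewrite leNgt; apply/negP => gneg.
near (complex.Im s1)^'+ => v.
have : 0 <= g v by apply: g_off; rewrite gt_eqF//; near: v; exact: nbhs_right_gt.
apply/negP; rewrite -ltNge; near: v.
apply: (cvgr_lt (g (complex.Im s1))) gneg; apply: cvg_at_right_filter.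
exact: continuous_rdot_line.
Unshelve. all: by end_near.
Qed.

(** * Residues at simple poles *)

Lemma continuous_horner_numField (K : numFieldType) (p : {poly K}) :
  continuous (fun s : K => p.[s] : K).
Proof.
elim/poly_ind: p => [|p c ih].
  rewrite (_ : (fun s : K => _) = cst (0 : K)). exact: cst_continuous.
  by apply/funext => s; rewrite /= horner0.
rewrite (_ : (fun s : K => _) = (fun s : K => p.[s] * s + c : K)); last first.
  by apply/funext => s; rewrite /= hornerMXaddC.
move=> x.
have h1 : p.[s] * s @[s --> (x : K)] --> p.[x] * x.
  apply: (@cvgM K K (nbhs (x : K)) _ (horner p) id); [exact: ih|exact: cvg_id].
exact: (@cvgD K K K (nbhs (x : K)) _ (fun s => p.[s] * s) (cst c)
  _ _ h1 (cvg_cst c)).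
Qed.

(** A punctured limit of [p / q] at a point where [q] is nonzero is its value
    there. *)
Lemma lim_dnbhs_div_horner (K : numFieldType) (p q : {poly K})
    (f : K -> K) (x l : K) :
  q.[x] != 0 -> (forall y, y != x -> f y = p.[y] / q.[y]) ->
  f @ x^' --> l -> p.[x] / q.[x] = l.
Proof.
move=> qx fE fl.
have pq : p.[y] / q.[y] @[y --> x] --> p.[x] / q.[x].
  apply: (@cvgM K K (nbhs x) _ (horner p) (fun y => (q.[y])^-1)).
    exact: continuous_horner_numField.
  apply: (@cvgV K K (nbhs x) _ (horner q)) => //.
  exact: continuous_horner_numField.
apply: (@cvg_unique K (@norm_hausdorff K K) (f @ x^')) fl.
apply: cvg_trans (cvg_within_filter _ pq); apply: near_eq_cvg; near=> y.
by rewrite fE//; near: y; exact: nbhs_dnbhs_neq.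
Unshelve. all: by end_near.
Qed.

(** The residue at [s0] is the value at [s0] of the numerator divided by the
    cofactor of [s - s0] in the denominator. *)
Lemma residue_horner (R : realType) (G : transfer_function R) (s0 r : R[i])
    (Q1 : {poly R[i]}) :
  tf_simple_pole_residue G s0 r ->
  polyC_of (tf_den G) = Q1 * ('X - s0%:P) ->
  Q1.[s0] != 0 /\ (polyC_of (tf_num G)).[s0] = r * Q1.[s0].
Proof.
set N := polyC_of (tf_num G); set D := polyC_of (tf_den G).
move=> [simple lim_r] ED.
have D0 : D != 0 by rewrite map_poly_eq0 tf_den_neq0.
have Q10 : Q1 != 0.
  by apply: contraNneq D0 => Q10; rewrite ED Q10 mul0r.
have Q1s0 : Q1.[s0] != 0.
  rewrite -rootE; apply/negP => /factor_theorem[Q2 EQ1].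
  have : (mup s0 D < 2)%N by rewrite [mup _ _]simple.
  by rewrite mup_ltn// ED EQ1 -mulrA -expr2 dvdp_mull.
split=> //; apply/(canRL (divfK Q1s0)).
apply: (lim_dnbhs_div_horner _ _ _ _ _ _ Q1s0 _ lim_r) => s ss0 /=.
rewrite /tf_eval -/N -/D ED hornerM hornerXsubC invfM mulrC -!mulrA.
by rewrite mulVf ?mulr1// subr_eq0.
Qed.

(** * Powers of points of the imaginary axis *)

(** The argument of such a power is [alpha * pi / 2] up to sign. *)
Lemma Re_cpow_axis_ge0 (R : realType) (w alpha : R) :
  0 < alpha -> alpha <= 1 -> 0 <= complex.Re (cpow (0 +i* w) alpha).
Proof.
move=> a0 a1.
have [w0|w0] := leP 0 w.
  have -> : 0 +i* w = cpolar w (pi / 2).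
    by rewrite /cpolar cos_pihalf sin_pihalf mulr0 mulr1.
  have p0 := @pi_gt0 R.
  rewrite cpow_polar//; last by apply/andP; split; lra.
  rewrite /= mulr_ge0 ?powR_ge0// cos_ge0_pihalf//; apply/andP; split; nra.
have -> : 0 +i* w = cpolar (- w) (- (pi / 2)).
  by rewrite /cpolar cosN sinN cos_pihalf sin_pihalf mulr0 mulrNN mulr1.
have p0 := @pi_gt0 R.
rewrite cpow_polar ?oppr_ge0 ?(ltW w0)//; last by apply/andP; split; lra.
rewrite /= mulr_ge0 ?powR_ge0// cos_ge0_pihalf//; apply/andP; split; nra.
Qed.

Theorem mainTheorem1 (R : realType) (G : transfer_function R) (alpha : R)
    (hproper : proper_tf G)
    (hrhp : forall s : R[i], tf_pole G s -> ~ (0 < complex.Re s))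
    (halpha0 : 0 < alpha) (halpha1 : alpha <= 1) :
  ((forall s : R[i], tf_pole G s -> complex.Re s = 0 ->
      exists r : R, 0 < r /\ tf_simple_pole_residue G s r%:C) ->
   forall a : R,
     (forall w : R, ~ tf_pole G (0 +i* w) ->
        a <= complex.Re (tf_eval G (0 +i* w))) ->
     forall w : R, ~ tf_pole G (cpow (0 +i* w) alpha) ->
       a <= complex.Re (tf_eval G (cpow (0 +i* w) alpha)))
  /\
  ((forall s : R[i], tf_pole G s -> complex.Re s <> 0) ->
   forall b : R,
     (forall w : R, complex.Re (tf_eval G (0 +i* w)) <= b) ->
     forall w : R, complex.Re (tf_eval G (cpow (0 +i* w) alpha)) <= b).
Proof.
set N := polyC_of (tf_num G); set D := polyC_of (tf_den G).
have D0 : D != 0 by rewrite map_poly_eq0 tf_den_neq0.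
have ND : (size N <= size D)%N by rewrite !size_map_poly.
have Rcpow w := Re_cpow_axis_ge0 _ w _ halpha0 halpha1.
have size_shift (a b : R) : (size (a%:C *: N + b%:C *: D)%R <= size D)%N.
  rewrite (leq_trans (size_polyD _ _))// geq_max.
  by rewrite (leq_trans (size_scale_leq _ _))//= size_scale_leq.
have shift (a b : R) s : D.[s] != 0 ->
    complex.Re ((a%:C *: N + b%:C *: D).[s] / D.[s]) =
    a * complex.Re (tf_eval G s) + b.
  move=> Ds; rewrite hornerD !hornerZ mulrDl mulfK// -mulrA.
  by rewrite Re_addc Re_real_mulc.
have rdot_axis (P : {poly R[i]}) (s : R[i]) :
    (D.[s] != 0 -> 0 <= complex.Re (P.[s] / D.[s])) ->
    0 <= rdot P.[s] D.[s].
  have [->|Ds] := eqVneq D.[s] 0; first by rewrite /rdot /= !mulr0 addr0.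
  move=> /(_ isT); rewrite Re_div_rdot pmulr_lge0// invr_gt0.
  exact: rdotxx_gt0.
split=> [simple a axis w /negP npole|nopole b axis w].
  rewrite -subr_ge0 -[X in X - _]mul1r -shift//.
  apply: Re_div_ge0 => // [s Q1 Rs ED|v].
    have Ds : D.[s] = 0 by rewrite ED hornerM hornerXsubC subrr mulr0.
    have [|r [r0 /residue_horner/(_ ED)[Q1s Ns]]] := simple s _ Rs.
      by rewrite /tf_pole rootE -/D Ds.
    exists r; split=> //.
    by rewrite hornerD !hornerZ Ds mulr0 addr0 mul1r.
  apply: rdot_axis => Dv; rewrite shift// mul1r subr_ge0 axis//.
  by apply/negP.
have Dn0 (s : R[i]) : 0 <= complex.Re s -> D.[s] != 0.
  rewrite le_eqVlt => Rs; apply/negP => /eqP Ds.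
  have ps : tf_pole G s by rewrite /tf_pole rootE -/D Ds.
  by case/predU1P: Rs => [Rs|]; [exact: (nopole s)|exact: hrhp].
rewrite -subr_ge0 addrC -mulN1r -shift ?Dn0//.
apply: Re_div_ge0 => //; last by rewrite Dn0.
  move=> s Q1 Rs ED; have := Dn0 s; rewrite Rs => /(_ (lexx _)).
  by rewrite ED hornerM hornerXsubC subrr mulr0 eqxx.
move=> v; apply: rdot_axis => Dv.
by rewrite shift// mulN1r addrC subr_ge0.
Qed.
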